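(* Given an invitation-depressed monotone (ID-MON) allocation rule $f$ and a profile $\theta$, for each bidder $i$ let $\tilde p_i=v_i^\ast(\emptyset)$, $\bar p_i=v_i^\ast(\emptyset)-v_i^\ast(r_i)$, and let $p^\ast=\{f_i(\theta)\tilde p_i+(1-f_i(\theta))\bar p_i\}_{i\in N}$. Then $\mathcal M^\ast=(f,p^\ast)$ is individually rational and strategyproof, and for any other individually rational and strategyproof mechanism $\mathcal M'=(f,p')$ (with the same allocation rule), $\mathrm{Rev}^{\mathcal M^\ast}(\theta)\ge \mathrm{Rev}^{\mathcal M'}(\theta)$.
   Context: Network auction model. There is a finite set $N$ of bidders and a seller. Bidder $i$ has true type $\theta_i=(v_i,r_i)$, where $v_i\in\mathbb R_{\ge0}$ is her value for winning and $r_i$ is her set of neighbors in the social network (those she can invite); $\theta=(\theta_i)_{i\in N}$. She reports $\theta_i'=(v_i',r_i')\in\Theta_i=\mathbb R_{\ge 0}\times\mathcal P(r_i)$, where $\mathcal P(r_i)$ is the power set of $r_i$; $\Theta=\times_{i\in N}\Theta_i$. A mechanism is $\mathcal M=(f,p)$ with $f_i:\Theta\to\{0,1\}$ and $p_i:\Theta\to\mathbb R$; the utility of $i$ is $u_i(\theta')=f_i(\theta')v_i-p_i(\theta')$; the seller's revenue is $\mathrm{Rev}^{\mathcal M}(\theta')=\sum_{i\in N}p_i(\theta')$. Individually rational: $u_i((v_i,r_i'),\theta'_{-i})\ge0$ for all $\theta'\in\Theta$, all $i\in N$ and all $r_i'\subseteq r_i$. Strategyproof: $u_i((v_i,r_i),\theta'_{-i})\ge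 u_i((v_i',r_i'),\theta'_{-i})$ for all $\theta'\in\Theta$ and all $i\in N$. Invitation-depressed partial order: $(v_i^1,r_i^1)\succeq_{\mathcal D}(v_i^2,r_i^2)$ if $v_i^1\ge v_i^2$ and $r_i^1\subseteq r_i^2$. $f$ is ID-MON if for every bidder $i$ and every profile $\theta_{-i}$ of the others, $f_i(\theta_i,\theta_{-i})=1$ implies $f_i(\theta_i',\theta_{-i})=1$ for all $\theta_i'\succeq_{\mathcal D}\theta_i$. For a fixed profile of the other bidders, the critical winning bid of $i$ under invitation action $r_i'$ is $v_i^\ast(r_i')=\inf\{x\in\mathbb R_{\ge0}: f_i((x,r_i'),\theta_{-i})=1\}$. Here $\tilde p_i$ and $\bar p_i$ are the payments of $i$ when winning and when losing; at a general report profile $\theta'$ the payment is given by the same formula with the critical bids computed from $\theta'_{-i}$ and the reported set $r_i'$ in place of $r_i$.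
   Formalization: It is added that whenever v_i*(∅) is finite, v_i*(r_i') is finite for every r_i' ⊆ r_i, since otherwise the losing payment is −∞ (e.g. f_i=1 iff r_i'=∅); for a bidder who can never win, the undefined ∞−∞ is read as payment 0. *)

(* Defs.v *)
From HB Require Import structures.
From mathcomp Require Import all_boot all_order all_algebra.
From mathcomp Require Import all_classical all_reals all_analysis.
Set Implicit Arguments.
Unset Strict Implicit.
Unset Printing Implicit Defensive.
Import Order.TTheory GRing.Theory Num.Theory.
Local Open Scope classical_set_scope.
Local Open Scope ring_scope.

(* A type or report of a bidder: a value and a set of (invited) neighbors. *)
Definition report (R : realType) (N : finType) : Type := (R * {set N})%type.

Definition profile (R : realType) (N : finType) : Type := N -> report R N.

Definition network (R : realType) (N : finType) (theta : profile R N) :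
    N -> {set N} :=
  fun i => (theta i).2.

(* The space Theta of report profiles when the true neighbor sets are [r].
   Allocation and payment rules are total functions on [profile R N], but all
   the notions below only look at their values on [Theta r]. *)
Definition Theta (R : realType) (N : finType) (r : N -> {set N}) :
    set (profile R N) :=
  [set th : profile R N | forall i, 0 <= (th i).1 /\ (th i).2 \subset r i].

(* The profile (t, th_{-i}). *)
Definition upd (R : realType) (N : finType) (th : profile R N) (i : N)
    (t : report R N) : profile R N :=
  [eta th with i |-> t].

Record mechanism (R : realType) (N : finType) := Mechanism {
  alloc : profile R N -> N -> bool;
  pay : profile R N -> N -> R
}.

(* [v] is the true value of [i], and [th] the profile of reports. *)
Definition utility (R : realType) (N : finType) (M : mechanism R N) (i : N)
    (v : R) (th : profile R N) : R :=
  (alloc M th i)%:R * v - pay M th i.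

Definition revenue (R : realType) (N : finType) (M : mechanism R N)
    (th : profile R N) : R :=
  \sum_(i : N) pay M th i.

(* Values are private, so the two incentive properties range over every
   possible true value [v] of bidder [i]. *)
Definition individually_rational (R : realType) (N : finType)
    (r : N -> {set N}) (M : mechanism R N) : Prop :=
  forall (th : profile R N) (i : N) (v : R) (s : {set N}),
    Theta r th -> 0 <= v -> s \subset r i ->
    0 <= utility M i v (upd th i (v, s)).

(* The arbitrary report (v_i', r_i') of bidder [i] is [th i]. *)
Definition strategyproof (R : realType) (N : finType)
    (r : N -> {set N}) (M : mechanism R N) : Prop :=
  forall (th : profile R N) (i : N) (v : R),
    Theta r th -> 0 <= v ->
    utility M i v (upd th i (v, r i)) >= utility M i v th.

Definition id_ge (R : realType) (N : finType) (t1 t2 : report R N) : Prop :=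
  t1.1 >= t2.1 /\ t1.2 \subset t2.2.

Definition id_mon (R : realType) (N : finType) (r : N -> {set N})
    (f : profile R N -> N -> bool) : Prop :=
  forall (th : profile R N) (i : N) (t : report R N),
    Theta r th -> Theta r (upd th i t) -> id_ge t (th i) ->
    f th i -> f (upd th i t) i.

(* The critical winning bid v_i^*(s) against th_{-i}; it is +oo when [i] cannot
   win with invitations [s], whatever her bid. *)
Definition critical_bid (R : realType) (N : finType)
    (f : profile R N -> N -> bool) (th : profile R N) (i : N) (s : {set N}) :
    \bar R :=
  ereal_inf [set x%:E | x in [set x : R | 0 <= x /\ f (upd th i (x, s)) i]].

(* The payments below are real numbers only if a bidder who can win while
   inviting nobody can also win (bidding enough) with any other invitations:
   otherwise v_i^*(set0) - v_i^*(s) is -oo (and, for an ID-MON [f], no payment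
   rule is strategyproof).  Bidders who cannot win at all
   (for instance those not reached by the invitations) are allowed. *)
Definition critical_bids_finite (R : realType) (N : finType)
    (r : N -> {set N}) (f : profile R N -> N -> bool) : Prop :=
  forall (th : profile R N) (i : N) (s : {set N}),
    Theta r th -> s \subset r i ->
    (critical_bid f th i finset.set0 < +oo)%E -> (critical_bid f th i s < +oo)%E.

Definition win_payment (R : realType) (N : finType)
    (f : profile R N -> N -> bool) (th : profile R N) (i : N) : R :=
  fine (critical_bid f th i finset.set0).

(* As [fine +oo = 0], the payment is 0 for a bidder who cannot win at all. *)
Definition lose_payment (R : realType) (N : finType)
    (f : profile R N -> N -> bool) (th : profile R N) (i : N) : R :=
  fine (critical_bid f th i finset.set0) - fine (critical_bid f th i (th i).2).

Definition optimal_payment (R : realType) (N : finType)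
    (f : profile R N -> N -> bool) (th : profile R N) (i : N) : R :=
  (f th i)%:R * win_payment f th i + (1 - (f th i)%:R) * lose_payment f th i.

Definition optimal_mechanism (R : realType) (N : finType)
    (f : profile R N -> N -> bool) : mechanism R N :=
  Mechanism f (optimal_payment f).

(* Main.v *)
Require Import Defs.
From HB Require Import structures.
From mathcomp Require Import all_boot all_order all_algebra.
From mathcomp Require Import all_classical all_reals all_analysis.
From mathcomp Require Import ring lra.
Set Implicit Arguments.
Unset Strict Implicit.
Unset Printing Implicit Defensive.
Import Order.TTheory GRing.Theory Num.Theory.
Local Open Scope ring_scope.

(* Against fixed reports of the others, the mechanism gives a truthful bidder
   the utility [max v v^*(r) - v^*(set0)], and [v^*] is nonnegative and
   monotone in the invitations, so neither underinviting nor misbidding pays.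
   For optimality, in any other mechanism the type [(y, r)] may deviate to a
   winning report [(x, set0)], which costs at most [x] by individual
   rationality.  So a winner pays at most [v^*(set0)]; a loser's payment does
   not depend on her losing bid [y], so it is at most [x - y], and letting
   [x] tend to [v^*(set0)] and [y] to [v^*(r)] gives the bound. *)

Section Profiles.
Variables (R : realType) (N : finType).
Implicit Types (th : profile R N) (i : N) (t u : report R N)
  (s : {set N}) (r : N -> {set N}).

Lemma upd_same th i t : upd th i t i = t.
Proof. by rewrite /upd /= eqxx. Qed.

Lemma upd_upd th i t u : upd (upd th i t) i u = upd th i u.
Proof. by apply/funext => j; rewrite /upd /=; case: (j == i). Qed.

Lemma upd_id th i : upd th i (th i) = th.
Proof. by apply/funext => j; rewrite /upd /=; case: eqP => [->|]. Qed.

Lemma Theta_upd r th i t :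
  Theta r th -> 0 <= t.1 -> t.2 \subset r i -> Theta r (upd th i t).
Proof. by move=> Hth t0 tr j; rewrite /upd /=; case: eqP => [->|]. Qed.

Lemma critical_bid_upd (f : profile R N -> N -> bool) th i t s :
  critical_bid f (upd th i t) i s = critical_bid f th i s.
Proof.
by rewrite /critical_bid; congr (ereal_inf (image _ _));
  apply/funext => x /=; rewrite upd_upd.
Qed.

End Profiles.

Section CriticalBid.
Variables (R : realType) (N : finType) (f : profile R N -> N -> bool).
Variable r : N -> {set N}.
Hypothesis f_mon : id_mon r f.
Implicit Types (th : profile R N) (i : N) (s : {set N}) (x : R).

Lemma alloc_mon th i x y s s' : Theta r th -> 0 <= x -> x <= y ->
  s \subset s' -> s' \subset r i ->
  f (upd th i (x, s')) i -> f (upd th i (y, s)) i.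
Proof.
move=> Hth x0 xy ss sr fx; rewrite -(upd_upd th i (x, s')); apply: f_mon fx.
- exact: Theta_upd.
- rewrite upd_upd; apply: Theta_upd => //=; first exact: le_trans xy.
  exact: fintype.subset_trans sr.
- by rewrite upd_same; split.
Qed.

Lemma critical_bid_ge0 th i s : (0 <= critical_bid f th i s)%E.
Proof. by apply: le_ereal_inf_tmp => _ [x [x0 _] <-]; rewrite lee_fin. Qed.

Lemma critical_bid_win th i s x :
  0 <= x -> f (upd th i (x, s)) i -> (critical_bid f th i s <= x%:E)%E.
Proof. by move=> x0 fx; apply: ereal_inf_lbound; exists x. Qed.

(** By monotonicity, a winning bid below [x] would make [x] win too, so [x] is a lower bound of the
    winning bids. *)
Lemma critical_bid_lose th i s x : Theta r th -> s \subset r i ->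
  0 <= x -> ~~ f (upd th i (x, s)) i -> (x%:E <= critical_bid f th i s)%E.
Proof.
move=> Hth sr x0 fx; apply: le_ereal_inf_tmp => _ [y [y0 fy] <-].
rewrite lee_fin leNgt; apply: contra fx => /ltW yx.
exact: alloc_mon fy.
Qed.

(** A bid that wins with [s'] still wins with fewer invitations, so the infimum for [s] runs over a
    larger set. *)
Lemma critical_bid_mon th i s s' : Theta r th -> s \subset s' ->
  s' \subset r i -> (critical_bid f th i s <= critical_bid f th i s')%E.
Proof.
move=> Hth ss sr; apply: le_ereal_inf_tmp => _ [y [y0 fy] <-].
by apply: critical_bid_win => //; apply: alloc_mon fy.
Qed.

Lemma critical_bid_fineK th i s : (critical_bid f th i s < +oo)%E ->
  (fine (critical_bid f th i s))%:E = critical_bid f th i s.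
Proof. by move=> c; rewrite fineK // ge0_fin_numE // critical_bid_ge0. Qed.

Lemma critical_bid_win_lty th i s x :
  0 <= x -> f (upd th i (x, s)) i -> (critical_bid f th i s < +oo)%E.
Proof.
by move=> x0 fx; apply: le_lt_trans (ltry x); apply: critical_bid_win.
Qed.

Lemma fine_critical_bid_win th i s x :
  0 <= x -> f (upd th i (x, s)) i -> fine (critical_bid f th i s) <= x.
Proof.
move=> x0 fx; rewrite -lee_fin critical_bid_fineK ?critical_bid_win //.
exact: critical_bid_win_lty fx.
Qed.

Hypothesis f_fin : critical_bids_finite r f.

Lemma fine_critical_bid_lose th i s x : Theta r th -> s \subset r i ->
  (critical_bid f th i finset.set0 < +oo)%E ->
  0 <= x -> ~~ f (upd th i (x, s)) i -> x <= fine (critical_bid f th i s).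
Proof.
move=> Hth sr c0 x0 fx; rewrite -lee_fin critical_bid_fineK; last exact: f_fin.
exact: critical_bid_lose.
Qed.

Lemma fine_critical_bid_mon th i s s' : Theta r th -> s \subset s' ->
  s' \subset r i ->
  fine (critical_bid f th i s) <= fine (critical_bid f th i s').
Proof.
move=> Hth ss sr.
have sr0 : s \subset r i by apply: fintype.subset_trans sr.
have [c0|] := ltP (critical_bid f th i finset.set0) +oo%E.
  by rewrite -lee_fin !critical_bid_fineK ?critical_bid_mon //; apply: f_fin.
(* A bidder who cannot win even when inviting nobody cannot win at all: every critical bid is [+oo],
   and [fine] sends both sides to 0. *)
rewrite leye_eq => /eqP c0.
have cy (u : {set N}) : u \subset r i -> critical_bid f th i u = +oo%E.
  move=> ur; apply/eqP; rewrite -leye_eq -c0.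
  exact: critical_bid_mon (finset.sub0set _) ur.
by rewrite !cy.
Qed.

(** The bid [w] matters only through whether it wins, and the subtracted term is fixed by the
    others' reports. Both incentive properties thus reduce to comparing [v] with critical bids. *)
Lemma utility_optimal th i v w s :
  utility (optimal_mechanism f) i v (upd th i (w, s)) =
  (if f (upd th i (w, s)) i then v else fine (critical_bid f th i s))
    - fine (critical_bid f th i finset.set0).
Proof.
rewrite /utility /= /optimal_payment /win_payment /lose_payment upd_same.
rewrite !critical_bid_upd; case: (f _ i) => /=; ring.
Qed.

Lemma optimal_mechanism_ir : individually_rational r (optimal_mechanism f).
Proof.
move=> th i v s Hth v0 sr; rewrite utility_optimal subr_ge0.
have cs :
    fine (critical_bid f th i finset.set0) <= fine (critical_bid f th i s).
  by rewrite fine_critical_bid_mon ?finset.sub0set.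
case: ifPn => // fv; apply: le_trans cs _; exact: fine_critical_bid_win.
Qed.

Lemma optimal_mechanism_sp : strategyproof r (optimal_mechanism f).
Proof.
move=> th i v Hth v0; rewrite -[X in utility _ i v X <= _](upd_id th i).
case E: (th i) => [w s]; have [/= w0 sr] := Hth i; rewrite E /= in w0 sr.
rewrite !utility_optimal lerD2r.
have cs := fine_critical_bid_mon Hth sr (subxx _).
case: ifPn => fw; case: ifPn => fv //.
- apply: fine_critical_bid_lose => //.
  (* The misreport wins, so [w] also wins with no invitations. Hence the critical bid at the empty
     set is finite, and by [f_fin] so is the one at [r i]. *)
  have f0 : f (upd th i (w, finset.set0)) i.
    by apply: alloc_mon fw => //; apply: finset.sub0set.
  exact: critical_bid_win_lty f0.
- apply: le_trans cs _; exact: fine_critical_bid_win.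
Qed.

Variable p' : profile R N -> N -> R.
Hypothesis p'_ir : individually_rational r (Mechanism f p').
Hypothesis p'_sp : strategyproof r (Mechanism f p').

(** Individual rationality is used at true value [x], to bound the payment at the report
    [(x, set0)]; strategyproofness is used at true value [v], against that report. *)
Lemma pay_le_deviation th i v x : Theta r th -> 0 <= v -> 0 <= x ->
  f (upd th i (x, finset.set0)) i ->
  p' (upd th i (v, r i)) i <= x - (~~ f (upd th i (v, r i)) i)%:R * v.
Proof.
move=> Hth v0 x0 fx.
have := @p'_ir _ i _ _ Hth x0 (finset.sub0set (r i)); rewrite /utility /= fx.
have Hx : Theta r (upd th i (x, finset.set0)).
  by apply: Theta_upd => //; apply: finset.sub0set.
have := @p'_sp _ i _ Hx v0; rewrite /utility /= upd_upd fx.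
by case: (f (upd th i (v, r i)) i) => /=; lra.
Qed.

(** A loser's utility is minus her payment, so a losing type would switch to any cheaper losing
    bid. *)
Lemma pay_lose_const th i v w : Theta r th -> 0 <= v -> 0 <= w ->
  ~~ f (upd th i (v, r i)) i -> ~~ f (upd th i (w, r i)) i ->
  p' (upd th i (v, r i)) i <= p' (upd th i (w, r i)) i.
Proof.
move=> Hth v0 w0 /negbTE fv /negbTE fw.
have Hw : Theta r (upd th i (w, r i)) by apply: Theta_upd.
have := @p'_sp _ i _ Hw v0; rewrite /utility /= upd_upd fv fw; lra.
Qed.

Lemma pay_le_optimal th i v : Theta r th -> 0 <= v ->
  p' (upd th i (v, r i)) i <= optimal_payment f (upd th i (v, r i)) i.
Proof.
move=> Hth v0; set P := p' _ i.
have -> : optimal_payment f (upd th i (v, r i)) i =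
    (f (upd th i (v, r i)) i)%:R * v
      - utility (optimal_mechanism f) i v (upd th i (v, r i)).
  by rewrite /utility /=; ring.
rewrite utility_optimal; set c := fun s => fine (critical_bid f th i s).
have le_c0 z : (critical_bid f th i finset.set0 < +oo)%E ->
    (forall x, 0 <= x -> f (upd th i (x, finset.set0)) i -> z <= x) ->
    z <= c finset.set0.
  move=> c0 zx; rewrite -lee_fin critical_bid_fineK //.
  by apply: le_ereal_inf_tmp => _ [x [x0 fx] <-]; rewrite lee_fin zx.
have [c0|] := ltP (critical_bid f th i finset.set0) +oo%E; last first.
  (* If [i] can never win, the optimal payment is 0, and individual rationality makes a loser's
     payment nonpositive. *)
  rewrite leye_eq => /eqP c0.
  have cr : critical_bid f th i (r i) = +oo%E.
    apply/eqP; rewrite -leye_eq -c0.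
    exact: critical_bid_mon (finset.sub0set _) _.
  have := @p'_ir _ i _ _ Hth v0 (subxx (r i)); rewrite /utility /= -/P c0 cr.
  case: ifPn => [fv|_] /=; last lra.
  by have := critical_bid_win_lty v0 fv; rewrite cr ltxx.
case: ifPn => fv /=.
  rewrite mul1r opprB addrCA subrr addr0; apply: le_c0 => // x x0 fx.
  by have := pay_le_deviation Hth v0 x0 fx; rewrite fv mul0r subr0.
rewrite mul0r sub0r opprB -/(c _) -/(c (r i)) lerBrDr.
apply: le_c0 => // x x0 fx; rewrite -lerBrDl leNgt; apply/negP => lt_c.
(* All losing bids share the payment bound [P], so none exceeds [x - P]. *)
have le_y y : 0 <= y -> ~~ f (upd th i (y, r i)) i -> y <= x - P.
  move=> y0 fy; have := pay_le_deviation Hth y0 x0 fx; rewrite fy mul1r.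
  have := pay_lose_const Hth v0 y0 fv fy; rewrite -/P; lra.
have vx := le_y v v0 fv.
(* The midpoint of [x - P] and [c (r i)] is too large to lose and too small to win. It is a legal
   bid since [0 <= v <= x - P]. *)
have y0 : 0 <= (x - P + c (r i)) / 2 by lra.
have := le_y _ y0; case: (boolP (f _ i)) => [fy _|_ /(_ isT)]; last lra.
have := fine_critical_bid_win y0 fy; rewrite -/(c (r i)); lra.
Qed.

End CriticalBid.

Theorem theorem4p2 (R : realType) (N : finType)
    (f : profile R N -> N -> bool) (theta : profile R N)
    (theta_ge0 : forall i : N, 0 <= (theta i).1)
    (f_mon : id_mon (network theta) f)
    (f_fin : critical_bids_finite (network theta) f) :
  [/\ individually_rational (network theta) (optimal_mechanism f),
      strategyproof (network theta) (optimal_mechanism f)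
    & forall p' : profile R N -> N -> R,
        individually_rational (network theta) (Mechanism f p') ->
        strategyproof (network theta) (Mechanism f p') ->
        revenue (optimal_mechanism f) theta >= revenue (Mechanism f p') theta].
Proof.
split; [exact: optimal_mechanism_ir | exact: optimal_mechanism_sp |].
(* The revenue bound already holds bidder by bidder. *)
move=> p' p'_ir p'_sp; apply: ler_sum => i _ /=.
have Htheta : Theta (network theta) theta by move=> j; split.
have := pay_le_optimal f_mon p'_ir p'_sp i Htheta (theta_ge0 i).
by rewrite /network -surjective_pairing upd_id.
Qed.
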